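(* Let $\mathbf p=(p_1,p_2)\in\mathbb{C}^2$ with $\mathbf p\neq(0,0)$, and let $\boldsymbol{\lambda},\boldsymbol{\mu}\in\mathbb{C}^{\times}\times\mathbb{C}^{\times}$, $\alpha,\gamma\in\mathbb{C}$, $b_{\mathbf 0},b_{\mathbf 0}'\in\mathbb{C}^{\times}$. (1) $\Omega(\boldsymbol{\lambda},\alpha,b_{\mathbf 0})\cong\Omega(\boldsymbol{\mu},\gamma,b_{\mathbf 0}')$ as $L(p_1,p_2)$-modules if and only if $\boldsymbol{\lambda}=\boldsymbol{\mu}$ and $b_{\mathbf 0}=b_{\mathbf 0}'$; moreover, the only isomorphisms between $\Omega(\boldsymbol{\lambda},\alpha,b_{\mathbf 0})$ and $\Omega(\boldsymbol{\mu},\gamma,b_{\mathbf 0}')$ are scalar multiples of the linear map $\phi_{\boldsymbol{\lambda},\alpha,\gamma}:\Omega(\boldsymbol{\lambda},\alpha,b_{\mathbf 0})\to\Omega(\boldsymbol{\mu},\gamma,b_{\mathbf 0}')$ given by $(\partial_1+p_1\alpha)^i(\partial_2+p_2\alpha)^j\mapsto(\partial_1+p_1\gamma)^i(\partial_2+p_2\gamma)^j$ for all $i,j\in\mathbb{N}$. (2) $\Omega(\boldsymbol{\lambda},\alpha,b_{\mathbf 0})\cong\Omega(\boldsymbol{\mu},\gamma,b_{\mathbf 0}')$ as $\widetilde{L}(p_1,p_2)$-modules if and only if $\boldsymbol{\lambda}=\boldsymbol{\mu}$, $\alpha=\gamma$ and $b_{\mathbf 0}=b_{\mathbf 0}'$;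 moreover, the only isomorphisms between $\Omega(\boldsymbol{\lambda},\alpha,b_{\mathbf 0})$ and $\Omega(\boldsymbol{\mu},\gamma,b_{\mathbf 0}')$ are scalar multiples of the identity map.
   Context: $\mathbb{C}^{\times}=\mathbb{C}\setminus\{0\}$ and $\mathbb{N}$ is the set of nonnegative integers. For fixed $\mathbf p=(p_1,p_2)\in\mathbb{C}^2$, the generalized (centerless) Heisenberg-Virasoro algebra of rank two $L(p_1,p_2)$ is the complex Lie algebra spanned by $t^{\mathbf m},E(\mathbf m)$, $\mathbf m=(m_1,m_2)\in\mathbb{Z}^2$, with relations $[t^{\mathbf m},t^{\mathbf n}]=0$, $[t^{\mathbf m},E(\mathbf n)]=-|\mathbf m+\mathbf p,\mathbf n+\mathbf p|\,t^{\mathbf m+\mathbf n}$, $[E(\mathbf m),E(\mathbf n)]=-|\mathbf m+\mathbf p,\mathbf n+\mathbf p|\,E(\mathbf m+\mathbf n)$, where $|\mathbf m+\mathbf p,\mathbf n+\mathbf p|=(m_1+p_1)(n_2+p_2)-(m_2+p_2)(n_1+p_1)$. The Lie algebra $\widetilde{L}(p_1,p_2)$ is obtained from $L(p_1,p_2)$ by adjoining degree derivations $\partial_1,\partial_2$ with $[\partial_i,E(\mathbf m)]=m_iE(\mathbf m)$, $[\partial_i,t^{\mathbf m}]=(m_i+p_i)t^{\mathbf m}$ ($i=1,2$), $[\partial_1,\partial_2]=0$. For $\boldsymbol{\lambda}=(\lambda_1,\lambda_2)\in\mathbb{C}^{\times}\times\mathbb{C}^{\times}$, $\alpha\in\mathbb{C}$,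 $b_{\mathbf 0}\in\mathbb{C}^{\times}$, the $\widetilde L(p_1,p_2)$-module $\Omega(\boldsymbol{\lambda},\alpha,b_{\mathbf 0})$ is the polynomial space $\mathbb{C}[\partial_1,\partial_2]$ on which $\partial_1,\partial_2$ act by multiplication and, for $f\in\mathbb{C}[\partial_1,\partial_2]$, $E(\mathbf m)f(\partial_1,\partial_2)=\lambda_1^{m_1}\lambda_2^{m_2}[(m_2+p_2)(\partial_1+p_1\alpha)-(m_1+p_1)(\partial_2+p_2\alpha)]f(\partial_1-m_1,\partial_2-m_2)$, $t^{\mathbf m}f(\partial_1,\partial_2)=\lambda_1^{m_1}\lambda_2^{m_2}b_{\mathbf 0}f(\partial_1-m_1-p_1,\partial_2-m_2-p_2)$. It is regarded as an $L(p_1,p_2)$-module by restriction. *)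

(* Defs.v *)
From HB Require Import structures.
From mathcomp Require Import all_boot all_order all_algebra.
From mathcomp Require Import finmap ring.
From mathcomp Require Import monalg.

Set Implicit Arguments.
Unset Strict Implicit.
Unset Printing Implicit Defensive.

Import GRing.Theory.
Local Open Scope ring_scope.

Record lieAlgebra (K : fieldType) := LieAlgebra {
  lie_sort :> lmodType K;
  lie_bracket : lie_sort -> lie_sort -> lie_sort;
  lie_bracket_linl : forall y, linear (lie_bracket^~ y);
  lie_bracket_linr : forall x, linear (lie_bracket x);
  lie_bracketxx : forall x, lie_bracket x x = 0;
  lie_jacobi : forall x y z,
    lie_bracket x (lie_bracket y z) + lie_bracket y (lie_bracket z x)
      + lie_bracket z (lie_bracket x y) = 0 }.

Record lieHom (K : fieldType) (g h : lieAlgebra K) := LieHom {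
  lie_hom_fun :> {linear g -> h};
  lie_hom_bracket : forall x y,
    lie_hom_fun (lie_bracket x y)
      = lie_bracket (lie_hom_fun x) (lie_hom_fun y) }.

Record lieModule (K : fieldType) (g : lieAlgebra K) := LieModule {
  lmod_sort :> lmodType K;
  lie_act : g -> lmod_sort -> lmod_sort;
  lie_act_linl : forall v, linear (lie_act^~ v);
  lie_act_linr : forall x, linear (lie_act x);
  lie_act_bracket : forall x y v,
    lie_act (lie_bracket x y) v
      = lie_act x (lie_act y v) - lie_act y (lie_act x v) }.

Definition lie_mod_iso (K : fieldType) (g : lieAlgebra K)
    (V W : lieModule g) (psi : {linear V -> W}) : Prop :=
  (forall (x : g) (v : V), psi (lie_act x v) = lie_act x (psi v))
  /\ bijective psi.

Definition lie_mod_isomorphic (K : fieldType) (g : lieAlgebra K)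
    (V W : lieModule g) : Prop :=
  exists psi : {linear V -> W}, lie_mod_iso psi.

Section Restriction.
Variables (K : fieldType) (g h : lieAlgebra K) (i : lieHom g h).
Variable V : lieModule h.

Lemma restrict_linl (v : V) : linear (fun x : g => lie_act (i x) v).
Proof. by move=> c x y; rewrite linearP lie_act_linl. Qed.

Lemma restrict_linr (x : g) : linear (lie_act (i x) : V -> V).
Proof. exact: lie_act_linr. Qed.

Lemma restrict_bracket (x y : g) (v : V) :
  lie_act (i (lie_bracket x y)) v
    = lie_act (i x) (lie_act (i y) v) - lie_act (i y) (lie_act (i x) v).
Proof. by rewrite lie_hom_bracket lie_act_bracket. Qed.

Definition restrict : lieModule g :=
  LieModule restrict_linl restrict_linr restrict_bracket.

End Restriction.

Section Lift.
Variables (K : fieldType) (B : choiceType) (V : lmodType K).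
Implicit Types (f : B -> V) (x y : {malg K[B]}).

(* The linear extension of a map f defined on the basis B. *)
Definition lift f x : V := \sum_(b <- msupp x) x@_b *: f b.

Lemma liftEw f x (d : {fset B}) :
  (msupp x `<=` d)%fset -> lift f x = \sum_(b <- d) x@_b *: f b.
Proof.
move=> sxd; rewrite /lift (big_fset_incl _ sxd) // => b _ /mcoeff_outdom ->.
by rewrite scale0r.
Qed.

Lemma lift_is_linear f : linear (lift f).
Proof.
move=> c x y; pose d := (msupp x `|` msupp y `|` msupp (c *: x + y))%fset.
rewrite !(@liftEw _ _ d) /d ?fsubsetUr //; last 2 first.
- by apply: fsubset_trans (fsubsetUl _ _); rewrite fsubsetUr.
- by apply: fsubset_trans (fsubsetUl _ _); rewrite fsubsetUl.
rewrite scaler_sumr -big_split /=; apply: eq_bigr => b _.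
by rewrite mcoeffD mcoeffZ scalerDl scalerA.
Qed.

HB.instance Definition _ f :=
  GRing.isLinear.Build K {malg K[B]} V *:%R (lift f) (lift_is_linear f).

Lemma liftU f b : lift f << b >> = f b.
Proof.
rewrite (@liftEw _ _ [fset b]%fset) ?msuppU_le //.
by rewrite big_seq_fset1 mcoeffUU scale1r.
Qed.

Lemma linear_liftE (F : {malg K[B]} -> V) :
  linear F -> forall x, F x = lift (fun b => F << b >>) x.
Proof.
move=> linF x.
pose HF := GRing.isLinear.Build K {malg K[B]} V *:%R F linF.
pose F' : {linear {malg K[B]} -> V} := HB.pack F HF.
rewrite -[F]/(F' : _ -> _) {1}[x]monalgE linear_sum.
apply: eq_bigr => b _; rewrite -linearZ; congr (F' _).
apply/malgP => k; rewrite mcoeffZ !mcoeffU.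
by case: (b == k); rewrite ?mulr1n ?mulr1 ?mulr0n ?mulr0.
Qed.

Lemma eq_lift f f' : f =1 f' -> lift f =1 lift f'.
Proof. by move=> eqf x; apply: eq_bigr => b _; rewrite eqf. Qed.

Lemma linear_ext (F G : {malg K[B]} -> V) : linear F -> linear G ->
  (forall b, F << b >> = G << b >>) -> F =1 G.
Proof.
move=> linF linG eqFG x.
by rewrite (linear_liftE linF) (linear_liftE linG); apply: eq_lift.
Qed.

End Lift.

Section LieOfBasis.
(* br gives the brackets of the basis vectors << a >> of {malg K[B]}. *)
Variables (K : fieldType) (B : choiceType) (br : B -> B -> {malg K[B]}).

Definition basis_bracket (x y : {malg K[B]}) : {malg K[B]} :=
  lift (fun a => lift (br a) y) x.

Local Notation "[[ x , y ]]" := (basis_bracket x y).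

Lemma basis_bracketUU a b : [[<< a >>, << b >>]] = br a b.
Proof. by rewrite /basis_bracket !liftU. Qed.

Lemma basis_bracket_linl y : linear (basis_bracket^~ y).
Proof. exact: lift_is_linear. Qed.

Lemma basis_bracket_linr x : linear (basis_bracket x).
Proof.
move=> c y z; rewrite /basis_bracket /lift scaler_sumr -big_split /=.
apply: eq_bigr => a _; rewrite -/(lift _ _) linearP scalerDr.
by rewrite !scalerA mulrC.
Qed.

Hypothesis br_xx : forall a, br a a = 0.
Hypothesis br_anti : forall a b, br a b = - br b a.
Hypothesis br_jacobi : forall a b c,
  [[<< a >>, br b c]] + [[<< b >>, br c a]] + [[<< c >>, br a b]] = 0.

Lemma basis_bracketC x y : [[x, y]] = - [[y, x]].
Proof.
move: x; apply: linear_ext => [||a]; first exact: basis_bracket_linl.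
  by move=> c u v; rewrite basis_bracket_linr opprD scalerN.
move: y; apply: linear_ext => [||b]; first exact: basis_bracket_linr.
  by move=> c u v; rewrite basis_bracket_linl opprD scalerN.
by rewrite !basis_bracketUU br_anti.
Qed.

Lemma basis_bracketxx x : [[x, x]] = 0.
Proof.
have brD u v w : [[u, v + w]] = [[u, v]] + [[u, w]].
  by have := basis_bracket_linr u 1 v w; rewrite !scale1r.
have brDl u v w : [[v + w, u]] = [[v, u]] + [[w, u]].
  by have := basis_bracket_linl u 1 v w; rewrite !scale1r.
have brZ c u v : [[u, c *: v]] = c *: [[u, v]].
  have b0 : [[u, 0]] = 0 by have := brD u 0 0; rewrite addr0 => /esym/eqP;
    rewrite -subr_eq0 addrK => /eqP.
  by have := basis_bracket_linr u c v 0; rewrite b0 !addr0.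
have brZl c u v : [[c *: v, u]] = c *: [[v, u]].
  by rewrite basis_bracketC brZ -scalerN -basis_bracketC.
have U (b : B) (c : K) : << c *g b >> = c *: << b >> :> {malg K[B]}.
  apply/malgP => k; rewrite mcoeffZ !mcoeffU.
  by case: (b == k); rewrite ?mulr1n ?mulr1 ?mulr0n ?mulr0.
rewrite [x]monalgE; elim: (enum_fset _) => [|b s IHs].
  by rewrite big_nil; have := brZ 0 0 0; rewrite !scale0r.
have uu0 : [[<< x@_b *g b >>, << x@_b *g b >>]] = 0.
  by rewrite U brZ brZl basis_bracketUU br_xx !scaler0.
rewrite big_cons brD !brDl IHs uu0 addr0 add0r.
by rewrite [X in _ + X = _]basis_bracketC subrr.
Qed.

Lemma basis_jacobi x y z :
  [[x, [[y, z]]]] + [[y, [[z, x]]]] + [[z, [[x, y]]]] = 0.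
Proof.
have blr := basis_bracket_linr; have bll := basis_bracket_linl.
have aux c (u v u' v' u'' v'' : {malg K[B]}) :
    c *: u + v + (c *: u' + v') + (c *: u'' + v'')
    = c *: (u + u' + u'') + (v + v' + v'').
  by rewrite !scalerDr (addrACA (c *: u)) (addrACA (c *: u + c *: u')).
have lin0 : linear (fun _ : {malg K[B]} => 0 : {malg K[B]}).
  by move=> c u v; rewrite scaler0 addr0.
move: x; apply: linear_ext => // [c u v|a].
  by rewrite !(blr, bll) aux.
move: y; apply: linear_ext => // [c u v|b].
  by rewrite !(blr, bll) aux.
move: z; apply: linear_ext => // [c u v|c].
  by rewrite !(blr, bll) aux.
by rewrite !basis_bracketUU br_jacobi.
Qed.

Definition lie_of_basis : lieAlgebra K :=
  LieAlgebra basis_bracket_linl basis_bracket_linr basis_bracketxx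
    basis_jacobi.

Variables (V : lmodType K) (rho : B -> V -> V).
Hypothesis rho_linear : forall a, linear (rho a).
Hypothesis rho_br : forall a b v,
  lift (rho^~ v) (br a b) = rho a (rho b v) - rho b (rho a v).

Definition basis_act (x : lie_of_basis) (v : V) : V := lift (rho^~ v) x.

Lemma basis_act_linl v : linear (basis_act^~ v).
Proof. exact: lift_is_linear. Qed.

Lemma basis_act_linr x : linear (basis_act x).
Proof.
move=> c v w; rewrite /basis_act /lift scaler_sumr -big_split /=.
apply: eq_bigr => a _; rewrite rho_linear scalerDr.
by rewrite !scalerA mulrC.
Qed.

Lemma basis_act_bracket (x y : lie_of_basis) v :
  basis_act (lie_bracket x y) v
    = basis_act x (basis_act y v) - basis_act y (basis_act x v).
Proof.
have aux c (u u' w w' : V) : c *: u + u' - (c *: w + w')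
    = c *: (u - w) + (u' - w').
  by rewrite opprD addrACA scalerBr.
move: x; apply: linear_ext => [c u w|c u w|a].
- by rewrite [lie_bracket _ _]basis_bracket_linl basis_act_linl.
- by rewrite !basis_act_linl basis_act_linr aux.
move: y; apply: linear_ext => [c u w|c u w|b].
- by rewrite [lie_bracket _ _]basis_bracket_linr basis_act_linl.
- by rewrite !basis_act_linl basis_act_linr aux.
by rewrite /basis_act /= basis_bracketUU !liftU rho_br.
Qed.

Definition module_of_basis : lieModule lie_of_basis :=
  LieModule basis_act_linl basis_act_linr basis_act_bracket.

End LieOfBasis.

(* << T m >> is t^m and << E m >> is E(m). *)
Inductive hv_gen := T of int * int | E of int * int.

Definition hv_gen_code (a : hv_gen) : (int * int) + (int * int) :=
  match a with T m => inl m | E m => inr m end.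
Definition hv_gen_decode (s : (int * int) + (int * int)) : hv_gen :=
  match s with inl m => T m | inr m => E m end.
Lemma hv_gen_codeK : cancel hv_gen_code hv_gen_decode.
Proof. by case. Qed.
HB.instance Definition _ := Choice.copy hv_gen (can_type hv_gen_codeK).

(* << Der1 >>, << Der2 >> are the two degree derivations. *)
Inductive hvd_gen := Gen of hv_gen | Der1 | Der2.

Definition hvd_gen_code (a : hvd_gen) : hv_gen + bool :=
  match a with Gen x => inl x | Der1 => inr true | Der2 => inr false end.
Definition hvd_gen_decode (s : hv_gen + bool) : hvd_gen :=
  match s with inl x => Gen x | inr b => if b then Der1 else Der2 end.
Lemma hvd_gen_codeK : cancel hvd_gen_code hvd_gen_decode.
Proof. by case. Qed.
HB.instance Definition _ := Choice.copy hvd_gen (can_type hvd_gen_codeK).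

Section HeisenbergVirasoro.
Variables (K : fieldType) (p : K * K).
Implicit Types (m n : int * int).

Definition ishift m : K * K := (m.1%:~R + p.1, m.2%:~R + p.2).

Definition det2 (u v : K * K) : K := u.1 * v.2 - u.2 * v.1.

Definition hv_br (a b : hv_gen) : {malg K[hv_gen]} :=
  match a, b with
  | T m, T n => 0
  | T m, E n => - det2 (ishift m) (ishift n) *: << T (m + n) >>
  | E m, T n => det2 (ishift n) (ishift m) *: << T (n + m) >>
  | E m, E n => - det2 (ishift m) (ishift n) *: << E (m + n) >>
  end.

(* Eigenvalues of the two degree derivations. *)
Definition weight (a : hv_gen) : K * K :=
  match a with
  | T m => (m.1%:~R + p.1, m.2%:~R + p.2)
  | E m => (m.1%:~R, m.2%:~R)
  end.

Definition hv_incl : {linear {malg K[hv_gen]} -> {malg K[hvd_gen]}} :=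
  lift (fun a => << Gen a >>).

Definition hvd_br (a b : hvd_gen) : {malg K[hvd_gen]} :=
  match a, b with
  | Gen x, Gen y => hv_incl (hv_br x y)
  | Der1, Gen x => (weight x).1 *: << Gen x >>
  | Der2, Gen x => (weight x).2 *: << Gen x >>
  | Gen x, Der1 => - (weight x).1 *: << Gen x >>
  | Gen x, Der2 => - (weight x).2 *: << Gen x >>
  | _, _ => 0
  end.

Lemma hv_br_xx a : hv_br a a = 0.
Proof.
by case: a => m //=; rewrite /det2 [X in - X](_ : _ = 0) ?oppr0 ?scale0r //; ring.
Qed.

Lemma hv_br_anti a b : hv_br a b = - hv_br b a.
Proof.
case: a b => m [] n //=; rewrite ?oppr0 // ?scaleNr ?opprK //.
by rewrite -scaleNr addrC; congr (_ *: _); rewrite /det2; ring.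
Qed.

Lemma bracketUZ (B : choiceType) (br : B -> B -> {malg K[B]}) a c b :
  basis_bracket br << a >> (c *: << b >>) = c *: br a b.
Proof.
have -> : c *: << b >> = c *: << b >> + 0 :> {malg K[B]} by rewrite addr0.
rewrite basis_bracket_linr basis_bracketUU.
have /= := basis_bracket_linr br << a >> (- 1) 0 0.
by rewrite scaler0 addr0 scaleN1r addNr => ->; rewrite addr0.
Qed.

Lemma bracketU0 (B : choiceType) (br : B -> B -> {malg K[B]}) a :
  basis_bracket br << a >> 0 = 0.
Proof. by rewrite -[X in basis_bracket _ _ X](scale0r << a >>) bracketUZ scale0r. Qed.

Lemma scale3 (B : choiceType) (x y z : K) (a b c : B) :
  a = b -> c = b -> x + y + z = 0 ->
  x *: << a >> + y *: << b >> + z *: << c >> = 0 :> {malg K[B]}.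
Proof. by move=> -> -> xyz; rewrite -!scalerDl xyz scale0r. Qed.

Lemma scale3_0 (B : choiceType) (x y z : K) (a b c : B) :
  x = 0 -> y = 0 -> z = 0 ->
  x *: << a >> + y *: << b >> + z *: << c >> = 0 :> {malg K[B]}.
Proof. by move=> -> -> ->; rewrite !scale0r !addr0. Qed.

Lemma zpairP m n : m.1 = n.1 -> m.2 = n.2 -> m = n.
Proof. by case: m n => [? ?] [? ?] /= -> ->. Qed.

Let hv_coef (a b : hv_gen) : K :=
  match a, b with
  | T m, T n => 0
  | T m, E n => - det2 (ishift m) (ishift n)
  | E m, T n => det2 (ishift n) (ishift m)
  | E m, E n => - det2 (ishift m) (ishift n)
  end.
Let hv_add (a b : hv_gen) : hv_gen :=
  match a, b with
  | T m, T n => T (m + n)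
  | T m, E n => T (m + n)
  | E m, T n => T (n + m)
  | E m, E n => E (m + n)
  end.

Let hv_brE a b : hv_br a b = hv_coef a b *: << hv_add a b >>.
Proof. by case: a b => m [] n //=; rewrite scale0r. Qed.

Lemma hv_jacobi a b c :
  basis_bracket hv_br << a >> (hv_br b c)
    + basis_bracket hv_br << b >> (hv_br c a)
    + basis_bracket hv_br << c >> (hv_br a b) = 0.
Proof.
rewrite (hv_brE b) (hv_brE c) (hv_brE a) !bracketUZ.
rewrite (hv_brE a) (hv_brE b) (hv_brE c) !scalerA.
case: a b c => m [] n [] k; rewrite /hv_add /hv_coef.
all: try by apply: scale3_0; rewrite ?mulr0 ?mul0r.
all: apply: scale3; [congr (_ _); apply: zpairP => /=; ring.. |].
all: rewrite ?mulr0 ?mul0r; rewrite /det2 /ishift /=; ring.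
Qed.

Lemma hvd_br_xx a : hvd_br a a = 0.
Proof. by case: a => [x||] //=; rewrite hv_br_xx linear0. Qed.

Lemma hvd_br_anti a b : hvd_br a b = - hvd_br b a.
Proof.
case: a b => [x||] [y||] //=; rewrite ?oppr0 ?scaleNr ?opprK //.
by rewrite hv_br_anti linearN.
Qed.

Lemma hv_incl_bracket x y :
  hv_incl (basis_bracket hv_br x y)
    = basis_bracket hvd_br (hv_incl x) (hv_incl y).
Proof.
move: x; apply: linear_ext => [c u v|c u v|a].
- by rewrite basis_bracket_linl linearP.
- by rewrite linearP basis_bracket_linl.
move: y; apply: linear_ext => [c u v|c u v|b].
- by rewrite basis_bracket_linr linearP.
- by rewrite linearP basis_bracket_linr.
by rewrite basis_bracketUU /= !liftU basis_bracketUU.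
Qed.

Lemma der1_incl a b :
  basis_bracket hvd_br << Der1 >> (hv_incl (hv_br a b))
    = ((weight a).1 + (weight b).1) *: hv_incl (hv_br a b).
Proof.
case: a b => m [] n /=; rewrite ?linear0 ?linearZ ?bracketU0 ?scaler0 //=.
all: rewrite liftU bracketUZ scalerA /= scalerA; congr (_ *: _); ring.
Qed.

Lemma der2_incl a b :
  basis_bracket hvd_br << Der2 >> (hv_incl (hv_br a b))
    = ((weight a).2 + (weight b).2) *: hv_incl (hv_br a b).
Proof.
case: a b => m [] n /=; rewrite ?linear0 ?linearZ ?bracketU0 ?scaler0 //=.
all: rewrite liftU bracketUZ scalerA /= scalerA; congr (_ *: _); ring.
Qed.

Lemma hvd_jacobi a b c :
  basis_bracket hvd_br << a >> (hvd_br b c)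
    + basis_bracket hvd_br << b >> (hvd_br c a)
    + basis_bracket hvd_br << c >> (hvd_br a b) = 0.
Proof.
have inclU (x : hv_gen) : << Gen x >> = hv_incl << x >> by rewrite /= liftU.
have sc0 (x : K) (u : {malg K[hvd_gen]}) : x = 0 -> x *: u = 0.
  by move=> ->; rewrite scale0r.
case: a b c => [x||] [y||] [z||] /=.
all: rewrite ?(bracketUZ, bracketU0, der1_incl, der2_incl) /= ?scaler0.
all: rewrite ?addr0 ?add0r ?scalerA //.
- rewrite !inclU -!hv_incl_bracket.
  by have := congr1 hv_incl (hv_jacobi x y z); rewrite linear0 2!linearD.
all: try rewrite (hv_br_anti y x); try rewrite (hv_br_anti z x).
all: try rewrite (hv_br_anti z y).
all: rewrite ?linearN ?scalerN -?scaleNr -!scalerDl; apply: sc0; ring.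
Qed.

Definition heisenberg_virasoro : lieAlgebra K :=
  lie_of_basis hv_br_xx hv_br_anti hv_jacobi.

Definition heisenberg_virasoro_der : lieAlgebra K :=
  lie_of_basis hvd_br_xx hvd_br_anti hvd_jacobi.

Definition hv_inclusion : lieHom heisenberg_virasoro heisenberg_virasoro_der :=
  @LieHom K heisenberg_virasoro heisenberg_virasoro_der hv_incl
    hv_incl_bracket.

End HeisenbergVirasoro.

From mathcomp Require Import mpoly.

(* monalg binds this notation in type_scope, which hides the one of mpoly. *)
Notation "{ 'mpoly' R [ n ] }" := (mpoly n R) : type_scope.

Notation nonzero K := {x : K | x != 0}.

Section Omega.
Variables (K : fieldType) (p : K * K).
Variables (lam : nonzero K * nonzero K) (alpha : K) (b : nonzero K).
Implicit Types (f g : {mpoly K[2]}) (m n : int * int) (u v : K * K).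

Definition partial1 : {mpoly K[2]} := 'X_0.
Definition partial2 : {mpoly K[2]} := 'X_1.

(* The substitution f(partial1 - u.1, partial2 - u.2). *)
Definition shift u f : {mpoly K[2]} :=
  f \mPo [tuple partial1 - u.1%:MP; partial2 - u.2%:MP].

Definition lam_pow m : K := val lam.1 ^ m.1 * val lam.2 ^ m.2.

Definition omega_act (a : hvd_gen) f : {mpoly K[2]} :=
  match a with
  | Gen (T m) =>
      (lam_pow m * val b) *: shift (m.1%:~R + p.1, m.2%:~R + p.2) f
  | Gen (E m) =>
      lam_pow m *:
        (((m.2%:~R + p.2)%:MP * (partial1 + (p.1 * alpha)%:MP)
          - (m.1%:~R + p.1)%:MP * (partial2 + (p.2 * alpha)%:MP))
         * shift (m.1%:~R, m.2%:~R) f)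
  | Der1 => partial1 * f
  | Der2 => partial2 * f
  end.

Lemma shift_is_linear u : linear (shift u).
Proof. by move=> c f g; rewrite /shift linearP. Qed.

Lemma shiftM u f g : shift u (f * g) = shift u f * shift u g.
Proof. by rewrite /shift rmorphM. Qed.
Lemma shiftD u f g : shift u (f + g) = shift u f + shift u g.
Proof. by rewrite /shift rmorphD. Qed.
Lemma shiftB u f g : shift u (f - g) = shift u f - shift u g.
Proof. by rewrite /shift rmorphB. Qed.
Lemma shiftZ u c f : shift u (c *: f) = c *: shift u f.
Proof. by rewrite /shift linearZ. Qed.
Lemma shiftC u c : shift u c%:MP = c%:MP.
Proof. by rewrite /shift comp_mpolyC. Qed.
Lemma shift1 u : shift u partial1 = partial1 - u.1%:MP.
Proof. by rewrite /shift comp_mpolyXU -tnth_nth. Qed.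
Lemma shift2 u : shift u partial2 = partial2 - u.2%:MP.
Proof. by rewrite /shift comp_mpolyXU -tnth_nth. Qed.

Lemma shift_shift u v f : shift u (shift v f) = shift (u + v) f.
Proof.
rewrite {2 3}/shift !comp_mpolyEX {1}/shift linear_sum.
apply: eq_bigr => m _; rewrite linearZ /= !comp_mpolyX rmorph_prod; congr (_ *: _).
apply: eq_bigr => i _; rewrite rmorphXn /=; congr (_ ^+ _).
rewrite -/(shift _ _) !(tnth_nth 0).
case: i => [[|[|//]] ?] /=; rewrite shiftB ?shift1 ?shift2 shiftC /=.
  by rewrite mpolyCD opprD addrA.
by rewrite mpolyCD opprD addrA.
Qed.

Lemma lam_powD m n : lam_pow (m + n) = lam_pow m * lam_pow n.
Proof.
rewrite /lam_pow /= !expfzDr ?(valP lam.1) ?(valP lam.2) //.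
by rewrite mulrACA.
Qed.

Lemma omega_act_linear a : linear (omega_act a).
Proof.
move=> c f g; case: a => [[m|m]||] /=.
- by rewrite shift_is_linear scalerDr !scalerA mulrC.
- by rewrite shift_is_linear mulrDr scalerDr -!scalerAr !scalerA mulrC.
- by rewrite mulrDr scalerAr.
- by rewrite mulrDr scalerAr.
Qed.

Lemma omega_act_gen_br x y f :
  lift (omega_act^~ f) (hv_incl K (hv_br p x y))
    = omega_act (Gen x) (omega_act (Gen y) f)
      - omega_act (Gen y) (omega_act (Gen x) f).
Proof.
have LZ k z : lift (omega_act^~ f) (hv_incl K (k *: << z >>))
    = k *: omega_act (Gen z) f.
  by rewrite !linearZ /= !liftU.
have S u v w : u + v = w -> shift u (shift v f) = shift w f.
  by move=> <-; rewrite shift_shift.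
case: x y => m [] n; rewrite /hv_br ?LZ /det2 /ishift; last 1 first.
- pose F := shift ((m + n).1%:~R, (m + n).2%:~R) f.
  rewrite /= !(shiftZ, shiftM, shiftB, shiftD, shift1, shift2, shiftC).
  rewrite (@S _ _ ((m + n).1%:~R, (m + n).2%:~R)); last first.
    by congr (_, _) => /=; ring.
  rewrite (@S _ _ ((m + n).1%:~R, (m + n).2%:~R)); last first.
    by congr (_, _) => /=; ring.
  rewrite -/F lam_powD -!mul_mpolyC /=.
  ring.
- rewrite !linear0 /= !shiftZ.
  pose w : K * K := ((m + n).1%:~R + p.1 + p.1, (m + n).2%:~R + p.2 + p.2).
  rewrite !(@S _ _ w); try by congr (_, _) => /=; ring.
  by rewrite !scalerA mulrC subrr.
- pose w : K * K := ((m + n).1%:~R + p.1, (m + n).2%:~R + p.2).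
  rewrite /= !(shiftZ, shiftM, shiftB, shiftD, shift1, shift2, shiftC) -/w.
  rewrite !(@S _ _ w); try by congr (_, _) => /=; ring.
  rewrite lam_powD -!mul_mpolyC /=.
  ring.
- pose w : K * K := ((n + m).1%:~R + p.1, (n + m).2%:~R + p.2).
  rewrite /= !(shiftZ, shiftM, shiftB, shiftD, shift1, shift2, shiftC) -/w.
  rewrite !(@S _ _ w); try by congr (_, _) => /=; ring.
  rewrite lam_powD -!mul_mpolyC /=.
  ring.
Qed.

Lemma omega_act_br x y f :
  lift (omega_act^~ f) (hvd_br p x y)
    = omega_act x (omega_act y f) - omega_act y (omega_act x f).
Proof.
have L0 : lift (omega_act^~ f) 0 = 0 by rewrite linear0.
have LZ k z : lift (omega_act^~ f) (k *: << z >>) = k *: omega_act z f.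
  by rewrite linearZ /= liftU.
case: x y => [x||] [y||]; rewrite /hvd_br ?L0 ?LZ.
- exact: omega_act_gen_br.
all: rewrite /= ?subrr //; try by rewrite mulrCA subrr.
all: first [case: x => m | case: y => m] => /=.
all: rewrite !(shiftM, shift1, shift2) -!mul_mpolyC /=; ring.
Qed.

Definition Omega_der : lieModule (heisenberg_virasoro_der p) :=
  @module_of_basis _ _ _ _ _ _ _ _ omega_act_linear omega_act_br.

(* Omega(lam, alpha, b) over L(p) is the restriction of the module over the
   algebra with degree derivations. *)
Definition Omega : lieModule (heisenberg_virasoro p) :=
  restrict (hv_inclusion p) Omega_der.

Lemma Omega_der_actU a (f : Omega_der) :
  lie_act (<< a >> : heisenberg_virasoro_der p) f = omega_act a f.
Proof. exact: liftU. Qed.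

Lemma Omega_actU x (f : Omega) :
  lie_act (<< x >> : heisenberg_virasoro p) f = omega_act (Gen x) f.
Proof. by rewrite /= liftU; apply: liftU. Qed.

End Omega.

(* Main.v *)
From HB Require Import structures.
Require Import Defs.
From mathcomp Require Import all_boot all_order all_algebra.
From mathcomp Require Import ring.
From mathcomp Require Import reals complex.
From mathcomp.multinomials Require Import mpoly.

Set Implicit Arguments.
Unset Strict Implicit.
Unset Printing Implicit Defensive.

Import GRing.Theory.
Local Open Scope ring_scope.

(** Write x = partial1, y = partial2, S_u f (x, y) = f (x - u.1, y - u.2), and
    let tau be the translation of C[x, y] sending x + p.1 alpha to
    x + p.1 gamma and y + p.2 alpha to y + p.2 gamma.  Translations commute
    with every S_u, so tau turns the action with parameter alpha into the one
    with parameter gamma: it is an isomorphism over L(p) as soon as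
    lam = mu and b = b'.

    Conversely, let psi be an isomorphism over L(p) and g = psi 1.  Applying
    psi to the actions of t^m and t^0 on 1 shows that g is an eigenvector of
    the integral shifts: S_m g = (lam / mu)^m g ([intertwiner_shift1]).  The
    operator E(m) is lam^m L_m S_m, with L_m multiplication by a linear form.
    When E(m) acts on S_(-m) h, the factor (mu / lam)^m coming from the two
    modules cancels against the eigenvalue of g, so that psi commutes with
    the L_m up to g and tau; the L_m span the multiplications by x + p.1 alpha
    and y + p.2 alpha, and an induction on polynomials yields
    psi f = g * tau f for all f ([intertwiner_mul]).  Since psi is onto, g
    divides 1, hence is a nonzero constant c; it is then fixed by all shifts,
    which forces lam = mu and b = b' ([intertwiner_iso]).

    An isomorphism over the algebra with degree derivations is in particular
    one over L(p), hence of the form c tau.  Commuting with multiplication by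
    x and y, it forces tau to fix x and y, i.e. p.1 (alpha - gamma) = 0 and
    p.2 (alpha - gamma) = 0; as p is not (0, 0), alpha = gamma and tau is the
    identity ([Omega_der_isoP]). *)

(** * Polynomials in two variables and their shifts *)

Section Polynomials.
Variable K : fieldType.
Implicit Types (f g h : {mpoly K[2]}) (u v : K * K).

Lemma mpoly2_ind (P : {mpoly K[2]} -> Prop) :
  P 1 -> (forall f, P f -> P (partial1 K * f)) ->
  (forall f, P f -> P (partial2 K * f)) ->
  (forall c f g, P f -> P g -> P (c *: f + g)) ->
  forall f, P f.
Proof.
move=> P1 PX PY PL f.
have P0 : P 0 by have := PL (-1) _ _ P1 P1; rewrite scaleN1r addNr.
rewrite [f]mpolyE; elim: (msupp f : seq _) => [|m s IHs].
  by rewrite big_nil.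
rewrite big_cons; apply: (PL) => //.
rewrite mpolyXE_id big_ord_recl big_ord1 /=.
have PXn n h : P h -> P (partial1 K ^+ n * h).
  by move=> Ph; elim: n => [|n IHn]; rewrite ?mul1r // exprS -mulrA; apply: PX.
have PYn n h : P h -> P (partial2 K ^+ n * h).
  by move=> Ph; elim: n => [|n IHn]; rewrite ?mul1r // exprS -mulrA; apply: PY.
have -> : lift ord0 ord0 = 1 :> 'I_2 by apply: val_inj.
by apply: PXn; rewrite -[X in P X]mulr1; apply: PYn.
Qed.

Lemma shift_one u : shift u 1 = 1 :> {mpoly K[2]}.
Proof. by rewrite -mpolyC1 shiftC. Qed.

Lemma shift0 f : shift (0, 0) f = f.
Proof.
elim/mpoly2_ind: f => [|f IHf|f IHf|c f g IHf IHg]; first exact: shift_one.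
- by rewrite shiftM shift1 subr0 IHf.
- by rewrite shiftM shift2 subr0 IHf.
- by rewrite shiftD shiftZ IHf IHg.
Qed.

Lemma shiftK u v : u + v = (0, 0) -> cancel (@shift K v) (shift u).
Proof. by move=> uv0 f; rewrite shift_shift uv0 shift0. Qed.

Lemma mpoly_mulr_eq1_const f g : f * g = 1 -> exists2 c, c != 0 & f = c%:MP.
Proof.
move=> fg1; have /andP[/eqP fC fU] : f \is a GRing.unit.
  by apply/unitrP; exists g; rewrite mulrC fg1.
by exists f@_0%MM => //; rewrite -unitfE.
Qed.

End Polynomials.

(** * Linear maps intertwining two actions *)

Section Intertwiners.
Variables (K : fieldType) (p : K * K).
Variables (lam mu : nonzero K * nonzero K) (alpha gamma : K).
Variables (b b' : nonzero K).
Implicit Types (f g h : {mpoly K[2]}) (m : int * int) (u v : K * K).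

(** The map phi_(lam, alpha, gamma) between the modules.  Writing it as a
    substitution makes it visibly multiplicative and bijective, instead of
    extending linearly from the monomials in partial1 + p.1 alpha and
    partial2 + p.2 alpha. *)
Definition omega_transl f :=
  shift (p.1 * (alpha - gamma), p.2 * (alpha - gamma)) f.

Lemma omega_transl_is_linear : linear omega_transl.
Proof. exact: shift_is_linear. Qed.

HB.instance Definition _ :=
  GRing.isLinear.Build K {mpoly K[2]} {mpoly K[2]} *:%R omega_transl
    omega_transl_is_linear.

Lemma omega_translM f g :
  omega_transl (f * g) = omega_transl f * omega_transl g.
Proof. exact: shiftM. Qed.

Lemma omega_transl_shift u f :
  omega_transl (shift u f) = shift u (omega_transl f).
Proof. by rewrite /omega_transl !shift_shift addrC. Qed.

Lemma omega_transl1 :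
  omega_transl (partial1 K + (p.1 * alpha)%:MP)
    = partial1 K + (p.1 * gamma)%:MP.
Proof.
by rewrite /omega_transl shiftD shift1 shiftC /= mulrBr mpolyCB; ring.
Qed.

Lemma omega_transl2 :
  omega_transl (partial2 K + (p.2 * alpha)%:MP)
    = partial2 K + (p.2 * gamma)%:MP.
Proof.
by rewrite /omega_transl shiftD shift2 shiftC /= mulrBr mpolyCB; ring.
Qed.

Lemma omega_transl_one : omega_transl 1 = 1.
Proof. exact: shift_one. Qed.

Lemma omega_transl_monomial i j :
  omega_transl ((partial1 K + (p.1 * alpha)%:MP) ^+ i
                * (partial2 K + (p.2 * alpha)%:MP) ^+ j)
  = (partial1 K + (p.1 * gamma)%:MP) ^+ i
    * (partial2 K + (p.2 * gamma)%:MP) ^+ j.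
Proof.
have translX n f : omega_transl (f ^+ n) = omega_transl f ^+ n.
  elim: n => [|n IHn]; first exact: omega_transl_one.
  by rewrite !exprS omega_translM IHn.
by rewrite omega_translM !translX omega_transl1 omega_transl2.
Qed.

Lemma omega_transl_act x f :
  omega_transl (omega_act p lam alpha b (Gen x) f)
    = omega_act p lam gamma b (Gen x) (omega_transl f).
Proof.
have translC c : omega_transl c%:MP = c%:MP by exact: shiftC.
case: x => m /=; first by rewrite linearZ /= omega_transl_shift.
rewrite linearZ /= omega_translM linearB /= !omega_translM !translC.
by rewrite omega_transl1 omega_transl2 omega_transl_shift.
Qed.

Lemma omega_actZ x c f :
  omega_act p lam alpha b (Gen x) (c *: f)
    = c *: omega_act p lam alpha b (Gen x) f.
Proof.
by case: x => m /=; rewrite shiftZ -?scalerAr !scalerA [in LHS]mulrC.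
Qed.

Lemma lam_pow_neq0 (l : nonzero K * nonzero K) m : lam_pow l m != 0.
Proof. by rewrite mulf_neq0 // expfz_neq0 ?(valP l.1) ?(valP l.2). Qed.

Variable psi : {linear {mpoly K[2]} -> {mpoly K[2]}}.
Hypothesis psi_act : forall x f,
  psi (omega_act p lam alpha b (Gen x) f)
    = omega_act p mu gamma b' (Gen x) (psi f).

(** On 1, shifts act trivially, so t^m only sees the scalar lam^m b; the
    eigenvalue equations of psi 1 for t^m and t^0 together remove the
    shift by p and the parameters b, b'. *)
Lemma intertwiner_shift1 m :
  lam_pow mu m *: shift (m.1%:~R, m.2%:~R) (psi 1) = lam_pow lam m *: psi 1.
Proof.
have actT1 n : (lam_pow lam n * val b) *: psi 1
    = (lam_pow mu n * val b') *: shift (n.1%:~R + p.1, n.2%:~R + p.2) (psi 1).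
  by have := psi_act (T n) 1; rewrite /= shift_one linearZ.
have := actT1 0; rewrite /lam_pow /= !expr0z !mul1r !add0r => actT01.
apply: (scalerI (valP b)); rewrite !scalerA [RHS]/= mulrC [in RHS]mulrC.
rewrite -[X in X *: _ = _]/(lam_pow mu m * val b).
by rewrite [RHS]actT1 -!scalerA -shiftZ actT01 shiftZ shift_shift.
Qed.

(** The factor psi 1 absorbs the quotient of lam^m by mu^m, so the formula holds
    before lam = mu is known; it reduces the bijectivity of psi to the
    invertibility of the polynomial psi 1. *)
Lemma intertwiner_mul f : psi f = psi 1 * omega_transl f.
Proof.
(* Quantifying over all shifts makes the property stable under the
   substitution of S_(-m) h for h in the action of E(m). *)
pose good h := forall u, psi (shift u h) = psi 1 * omega_transl (shift u h).
pose L a m : {mpoly K[2]} :=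
  (m.2%:~R + p.2)%:MP * (partial1 K + (p.1 * a)%:MP)
  - (m.1%:~R + p.1)%:MP * (partial2 K + (p.2 * a)%:MP).
have psiL m h : good h ->
    psi (L alpha m * h) = psi 1 * (L gamma m * omega_transl h).
  move=> gh; pose v : K * K := (m.1%:~R, m.2%:~R).
  have Sv : shift v (shift (- v) h) = h.
    by apply: shiftK; rewrite subrr.
  have := psi_act (E m) (shift (- v) h).
  rewrite /= -/(L alpha m) -/(L gamma m) -/v Sv linearZ /= gh shiftM.
  rewrite -omega_transl_shift Sv.
  (* The eigenvalue of psi 1 turns the factor mu^m into lam^m. *)
  rewrite mulrCA scalerAl intertwiner_shift1 -scalerAl.
  exact: (scalerI (lam_pow_neq0 lam m)).
have L1 a : L a (0, 1) - L a (0, 0) = partial1 K + (p.1 * a)%:MP.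
  by rewrite /L /= !mpolyCD; ring.
have L2 a : L a (0, 0) - L a (1, 0) = partial2 K + (p.2 * a)%:MP.
  by rewrite /L /= !mpolyCD; ring.
have good0 h : good h -> psi h = psi 1 * omega_transl h.
  by move=> gh; rewrite -[h]shift0 gh.
have psiDC D c h : good h ->
    psi ((D + c%:MP) * h) = psi 1 * omega_transl ((D + c%:MP) * h) ->
    psi (D * h) = psi 1 * omega_transl (D * h).
  move=> gh; rewrite mulrDl mul_mpolyC !linearD !linearZ /= (good0 h) //.
  by rewrite mulrDr -scalerAr => /addIr.
have psi1 h : good h ->
    psi (partial1 K * h) = psi 1 * omega_transl (partial1 K * h).
  move=> gh; apply: (psiDC _ (p.1 * alpha)) => //.
  rewrite omega_translM omega_transl1 -!L1 mulrBl [in RHS]mulrBl linearB /=.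
  by rewrite !psiL // -mulrBr.
have psi2 h : good h ->
    psi (partial2 K * h) = psi 1 * omega_transl (partial2 K * h).
  move=> gh; apply: (psiDC _ (p.2 * alpha)) => //.
  rewrite omega_translM omega_transl2 -!L2 mulrBl [in RHS]mulrBl linearB /=.
  by rewrite !psiL // -mulrBr.
have good_shift u h : good h -> good (shift u h).
  by move=> gh v; rewrite shift_shift gh.
suffices gf : good f by rewrite -[f]shift0 gf.
elim/mpoly2_ind: f => [|f gf|f gf|c f g gf gg] u.
- by rewrite shift_one omega_transl_one mulr1.
- rewrite shiftM shift1 mulrBl linearB /= psi1; last exact: good_shift.
  by rewrite !mul_mpolyC linearB !linearZ /= gf mulrDr -scalerAr mulrN.
- rewrite shiftM shift2 mulrBl linearB /= psi2; last exact: good_shift.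
  by rewrite !mul_mpolyC linearB !linearZ /= gf mulrDr -scalerAr mulrN.
- by rewrite shiftD shiftZ !linearP /= gf gg mulrDr -scalerAr.
Qed.

Lemma intertwiner_iso : bijective psi ->
  [/\ lam = mu, b = b'
    & exists2 c, c != 0 & forall f, psi f = c *: omega_transl f].
Proof.
case=> psiV _ psiVK.
have [c c0 psi1] : exists2 c, c != 0 & psi 1 = c%:MP.
  apply: (@mpoly_mulr_eq1_const _ _ (omega_transl (psiV 1))).
  by rewrite -intertwiner_mul psiVK.
have lamE m : lam_pow lam m = lam_pow mu m.
  have /esym := intertwiner_shift1 m.
  rewrite psi1 shiftC -!mul_mpolyC -!mpolyCM => /eqP.
  by rewrite mpolyC_eq => /eqP/(mulIf c0).
split.
- have := lamE (1, 0); have := lamE (0, 1).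
  rewrite /lam_pow /= !expr0z !expr1z !mul1r !mulr1.
  case: lam mu => [l1 l2] [m1 m2] /= e2 e1.
  by congr (_, _); apply: val_inj.
- apply: val_inj; have := psi_act (T 0) 1.
  rewrite /= shift_one linearZ /= psi1 shiftC -!mul_mpolyC -!mpolyCM => /eqP.
  rewrite mpolyC_eq lamE => /eqP/(mulIf c0).
  by apply: mulfI; apply: lam_pow_neq0.
- by exists c => // f; rewrite intertwiner_mul psi1 mul_mpolyC.
Qed.

End Intertwiners.

(** * Isomorphisms between the modules *)

Section ModuleIsomorphisms.
Variables (K : fieldType) (p : K * K).
Implicit Types (lam mu : nonzero K * nonzero K) (b : nonzero K).

Lemma omega_transl_id alpha f : omega_transl p alpha alpha f = f.
Proof. by rewrite /omega_transl subrr !mulr0 shift0. Qed.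

Lemma omega_transl_bij alpha gamma c : c != 0 ->
  bijective (fun f : {mpoly K[2]} => c *: omega_transl p alpha gamma f).
Proof.
move=> c0; exists (fun f => omega_transl p gamma alpha (c^-1 *: f)) => f.
  rewrite scalerA mulVf // scale1r /omega_transl.
  by apply: shiftK; congr (_, _) => /=; ring.
rewrite !linearZ /= scalerA mulVf // scale1r /omega_transl.
by apply: shiftK; congr (_, _) => /=; ring.
Qed.

Lemma Omega_isoP lam mu alpha gamma b b'
    (psi : {linear Omega p lam alpha b -> Omega p mu gamma b'}) :
  lie_mod_iso psi <->
  [/\ lam = mu, b = b'
    & exists2 c, c != 0 & forall f, psi f = c *: omega_transl p alpha gamma f].
Proof.
split=> [[psiA psi_bij]|[elam eb [c c0 psiE]]].
  apply: (@intertwiner_iso K p lam mu alpha gamma b b' psi) => // x f.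
  by rewrite -!Omega_actU; apply: psiA.
subst mu b'; split.
  move=> x v; move: x; apply: linear_ext => [k x y||a].
  - rewrite -linearP; congr (psi _).
    exact: (@lie_act_linl _ _ (Omega p lam alpha b)).
  - exact: (@lie_act_linl _ _ (Omega p lam gamma b)).
  by rewrite !Omega_actU !psiE omega_transl_act omega_actZ.
case: (omega_transl_bij alpha gamma c0) => g fK gK.
by exists g => f; rewrite psiE; [apply: fK | apply: gK].
Qed.

Lemma Omega_der_iso_restrict lam mu alpha gamma b b'
    (psi : {linear Omega_der p lam alpha b -> Omega_der p mu gamma b'}) :
  lie_mod_iso psi ->
  lie_mod_iso (psi : {linear Omega p lam alpha b -> Omega p mu gamma b'}).
Proof. by case=> psiA psi_bij; split=> // x v; apply: psiA. Qed.

(** Over L(p) the only candidates are the multiples of [omega_transl];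
    evaluating the intertwining of each degree derivation at 1 shows that the
    translation vector p (alpha - gamma) vanishes. *)
Lemma Omega_der_isoP lam mu alpha gamma b b'
    (psi : {linear Omega_der p lam alpha b -> Omega_der p mu gamma b'}) :
  p != (0, 0) ->
  lie_mod_iso psi <->
  [/\ lam = mu, alpha = gamma, b = b'
    & exists2 c, c != 0 & forall f : {mpoly K[2]}, psi f = c *: f].
Proof.
move=> p0; split=> [psi_iso|[elam ealpha eb [c c0 psiE]]]; last first.
  subst mu gamma b'; split.
    move=> x v; move: x; apply: linear_ext => [k x y||a].
    - rewrite -linearP; congr (psi _).
      exact: (@lie_act_linl _ _ (Omega_der p lam alpha b)).
    - exact: (@lie_act_linl _ _ (Omega_der p lam alpha b)).
    rewrite !Omega_der_actU !psiE; case: a => [x||] /=.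
    - by rewrite -omega_actZ.
    - by rewrite scalerAr.
    - by rewrite scalerAr.
  case: (omega_transl_bij alpha alpha c0) => g fK gK.
  exists g => f; rewrite psiE -[X in c *: X](omega_transl_id alpha).
    exact: fK.
  exact: gK.
have [elam eb [c c0 psiE]] := (Omega_isoP _).1 (Omega_der_iso_restrict psi_iso).
have [psiA _] := psi_iso.
have psi_act a (f : {mpoly K[2]}) :
    psi (omega_act p lam alpha b a f) = omega_act p mu gamma b' a (psi f).
  by rewrite -!Omega_der_actU; apply: psiA.
have psi1 : psi (1 : {mpoly K[2]}) = c *: 1 by rewrite psiE omega_transl_one.
have ealpha : alpha = gamma.
  have h1 : p.1 * (alpha - gamma) = 0.
    have := psi_act Der1 1; rewrite /= psiE psi1 omega_translM.
    rewrite omega_transl_one mulr1.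
    rewrite -scalerAr mulr1 /omega_transl shift1 => /(scalerI c0)/eqP.
    by rewrite subr_eq addrC -subr_eq subrr eq_sym mpolyC_eq0 => /eqP.
  have h2 : p.2 * (alpha - gamma) = 0.
    have := psi_act Der2 1; rewrite /= psiE psi1 omega_translM.
    rewrite omega_transl_one mulr1.
    rewrite -scalerAr mulr1 /omega_transl shift2 => /(scalerI c0)/eqP.
    by rewrite subr_eq addrC -subr_eq subrr eq_sym mpolyC_eq0 => /eqP.
  apply/eqP; rewrite -subr_eq0; apply: contraNT p0 => ag0.
  move/eqP: h1 h2; rewrite mulf_eq0 (negPf ag0) orbF => /eqP p10 /eqP.
  rewrite mulf_eq0 (negPf ag0) orbF => /eqP p20.
  by rewrite [p]surjective_pairing p10 p20.
split=> //; exists c => // f.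
by rewrite psiE ealpha omega_transl_id.
Qed.

End ModuleIsomorphisms.

Theorem theorem2p6 (R : realType) (p : R[i] * R[i]) (hp : p != (0, 0))
    (lam mu : nonzero R[i] * nonzero R[i]) (alpha gamma : R[i])
    (b b' : nonzero R[i]) :
  ((lie_mod_isomorphic (Omega p lam alpha b) (Omega p mu gamma b')
      <-> lam = mu /\ b = b')
   /\ exists phi : {linear Omega p lam alpha b -> Omega p mu gamma b'},
        (forall i j : nat,
           phi ((partial1 _ + (p.1 * alpha)%:MP) ^+ i
                * (partial2 _ + (p.2 * alpha)%:MP) ^+ j)
           = (partial1 _ + (p.1 * gamma)%:MP) ^+ i
             * (partial2 _ + (p.2 * gamma)%:MP) ^+ j)
        /\ (lam = mu -> b = b' ->
            forall psi : {linear Omega p lam alpha b -> Omega p mu gamma b'},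
              lie_mod_iso psi
              <-> exists2 c : R[i], c != 0 & forall f, psi f = c *: phi f))
  /\ ((lie_mod_isomorphic (Omega_der p lam alpha b) (Omega_der p mu gamma b')
        <-> [/\ lam = mu, alpha = gamma & b = b'])
     /\ (lam = mu -> alpha = gamma -> b = b' ->
         forall psi : {linear Omega_der p lam alpha b
                              -> Omega_der p mu gamma b'},
           lie_mod_iso psi
           <-> exists2 c : R[i], c != 0
                 & forall f : {mpoly R[i][2]}, psi f = c *: f)).
Proof.
split; split.
- split=> [[psi /Omega_isoP[]] //|[elam eb]].
  exists (omega_transl p alpha gamma
    : {linear {mpoly R[i][2]} -> {mpoly R[i][2]}}).
  apply/Omega_isoP; split=> //; exists 1; first exact: oner_neq0.
  by move=> f; rewrite scale1r.
- exists (omega_transl p alpha gamma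
    : {linear {mpoly R[i][2]} -> {mpoly R[i][2]}}).
  split=> [i j|elam eb psi]; first exact: omega_transl_monomial.
  by split=> [/Omega_isoP[]|psiE] //; apply/Omega_isoP.
- split=> [[psi /(Omega_der_isoP _ hp)[]] //|[elam ealpha eb]].
  exists (idfun : {linear {mpoly R[i][2]} -> {mpoly R[i][2]}}).
  apply/(Omega_der_isoP _ hp); split=> //; exists 1; first exact: oner_neq0.
  by move=> f; rewrite scale1r.
- move=> elam ealpha eb psi.
  by split=> [/(Omega_der_isoP _ hp)[]|psiE] //; apply/(Omega_der_isoP _ hp).
Qed.
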